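(* Let $d\ge 4$ and $a\ge 2$ be integers. Then the real number $f_d(a)=\prod_{t=0}^\infty(1-a^{-d^t})$ is well approximable. Moreover, the exponent of irrationality of $f_d(a)$ is at least $d-1$.
   Context: A real number $\xi$ is badly approximable if there is a constant $c=c(\xi)>0$ such that $0<|\xi-r/s|$ and $|\xi-r/s|\ge c/s^2$ for all integers $r,s$ with $s\ne0$; it is well approximable if it is not badly approximable. The exponent of irrationality of $\xi\in\mathbb{R}$ is the supremum of all positive real numbers $\tau$ such that the inequality $|\xi-\frac rs|<s^{-\tau}$ has infinitely many integer solutions $r,s$ with $s\neq0$ (denominators $s$ taken positive). *)

(* Defs.v *)
From HB Require Import structures.
From mathcomp Require Import all_boot all_order all_algebra.
From mathcomp Require Import all_classical all_reals all_analysis.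

Set Implicit Arguments.
Unset Strict Implicit.
Unset Printing Implicit Defensive.

Import Order.TTheory GRing.Theory Num.Theory.
Import numFieldNormedType.Exports.

Local Open Scope classical_set_scope.
Local Open Scope ring_scope.

Definition badly_approximable (R : realType) (xi : R) : Prop :=
  exists2 c : R, 0 < c &
    forall r s : int, s != 0 ->
      0 < `|xi - r%:~R / s%:~R| /\
      c / s%:~R ^+ 2 <= `|xi - r%:~R / s%:~R|.

Definition well_approximable (R : realType) (xi : R) : Prop :=
  ~ badly_approximable xi.

(* Solutions are pairs (r, s), not necessarily coprime, with s > 0 so that the
   real power s^(-tau) is meaningful. *)
Definition approximations (R : realType) (xi tau : R) : set (int * int) :=
  [set rs | 0 < rs.2 /\
            `|xi - rs.1%:~R / rs.2%:~R| < (rs.2%:~R : R) `^ (- tau)].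

(* The supremum is taken in \bar R, since it may be +oo. *)
Definition irrationality_exponent (R : realType) (xi : R) : \bar R :=
  ereal_sup [set tau%:E | tau in
    [set tau : R | 0 < tau /\ infinite_set (approximations xi tau)]].

Definition partial_product (R : realType) (d a : nat) : R ^nat :=
  fun n => \prod_(0 <= t < n) (1 - (a%:R : R) ^- (d ^ t)%N).

Definition f (R : realType) (d a : nat) : R :=
  limn (partial_product R d a).

(* The limit defining f exists, so f is not a default value of limn. *)
Lemma cvg_partial_product (R : realType) (d a : nat) :
  (2 <= a)%N -> partial_product R d a @ \oo --> f R d a.
Proof.
move=> a2.
have a1 : 1 <= (a%:R : R) by rewrite ler1n ltnW.
have F01 t : 0 <= 1 - (a%:R : R) ^- (d ^ t)%N <= 1.
  have e0 : 0 <= (a%:R : R) ^- (d ^ t)%N by rewrite invr_ge0 exprn_ge0.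
  rewrite subr_ge0 lerBlDr lerDl e0 andbT invf_le1 ?exprn_ege1 //.
  by rewrite exprn_gt0 // (lt_le_trans ltr01).
have P0 n : 0 <= partial_product R d a n.
  by apply: prodr_ge0 => t _; case/andP: (F01 t).
apply: (@nonincreasing_is_cvgn R).
  apply/nonincreasing_seqP => n.
  rewrite {1}/partial_product big_nat_recr //=.
  by apply: ler_piMr; [exact: P0 | case/andP: (F01 n)].
by exists 0 => _ [n _ <-]; exact: P0.
Qed.

(* Main.v *)
Require Import Defs.
From HB Require Import structures.
From mathcomp Require Import all_boot all_order all_algebra.
From mathcomp Require Import all_classical all_reals all_analysis.
From mathcomp Require Import ring.

Import Order.TTheory GRing.Theory Num.Theory.
Import numFieldNormedType.Exports.

Local Open Scope classical_set_scope.
Local Open Scope ring_scope.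

(** The partial products [p_n] are themselves the good approximations.  Write
    [x_n = a^(- d^n)].  The denominator [q_n = a^(1 + d + ... + d^(n-1))]
    clears all the fractions in [p_n], and summing the geometric progression
    in the exponent gives [q_n^(d-1) = a^(d^n - 1)], that is
    [a * x_n = q_n^(-(d-1))] ([tail_term_denominator]).  On the other hand the
    distance from [p_n] to the limit is about [p_n * x_n], because the factors
    tend to 1 doubly exponentially fast.  A clean way to see this is the
    enclosure [p_n * (1 - 2 x_n) <= f <= p_n], whose lower bound increases with
    [n] while the upper bound decreases ([partial_product_enclosure]).  Since
    [p_n < 1] for [n > 0] and [2 <= a], the error is less than
    [a * x_n = q_n^(-(d-1))] ([partial_product_error]).

    Hence the exponent [d - 1] is attained by infinitely many fractions.  When
    [4 <= d] the error is at most [q_n^(-3)], which beats [c / q_n^2] for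
    every [c > 0] because [q_n] is unbounded. *)

Definition denominator (d a n : nat) : nat := (a ^ \sum_(t < n) d ^ t)%N.

Definition numerator (d a n : nat) : nat :=
  (\prod_(0 <= t < n) (a ^ (d ^ t) - 1))%N.

Lemma denominator_gt0 (d a n : nat) : (2 <= a)%N -> (0 < denominator d a n)%N.
Proof. by move=> a2; rewrite expn_gt0 (ltn_trans _ a2). Qed.

Lemma denominator_ltnS (d a n : nat) : (0 < d)%N -> (2 <= a)%N ->
  (denominator d a n < denominator d a n.+1)%N.
Proof.
move=> d0 a2; rewrite /denominator ltn_exp2l // big_ord_recr /= -[ltnLHS]addn0.
by rewrite ltn_add2l expn_gt0 d0.
Qed.

Lemma denominator_inj (d a : nat) : (0 < d)%N -> (2 <= a)%N ->
  injective (denominator d a).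
Proof.
by move=> d0 a2; apply: incn_inj; apply: leq_mono; apply: (homo_ltn ltn_trans) => n;
  exact: denominator_ltnS.
Qed.

Lemma ltn_denominator (d a n : nat) : (0 < d)%N -> (2 <= a)%N ->
  (n < denominator d a n)%N.
Proof.
move=> d0 a2; elim: n => [|n IH]; first exact: denominator_gt0.
exact: leq_ltn_trans IH (denominator_ltnS _ _ _ d0 a2).
Qed.

Section PartialProducts.
Variables (R : realType) (d a : nat).
Hypotheses (d2 : (2 <= d)%N) (a2 : (2 <= a)%N).

Let x n : R := (a%:R : R) ^- (d ^ n)%N.
Let p := partial_product R d a.

Let a_gt0 : 0 < (a%:R : R).
Proof. by rewrite ltr0n (ltn_trans _ a2). Qed.

Let x_gt0 n : 0 < x n.
Proof. by rewrite invr_gt0 exprn_gt0. Qed.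

Let pS n : p n.+1 = p n * (1 - x n).
Proof. by rewrite /p /partial_product big_nat_recr. Qed.

Lemma tail_term_le_half n : 2 * x n <= 1.
Proof.
rewrite /x ler_pdivrMr ?exprn_gt0 // mul1r -natrX ler_nat.
apply: (leq_trans a2); rewrite -[leqLHS]expn1 leq_exp2l //.
by rewrite expn_gt0 (ltn_trans _ d2).
Qed.

Lemma tail_term_halves n : 2 * x n.+1 <= x n.
Proof.
have xS : x n.+1 <= x n * x n.
  rewrite /x -invfM -exprD lef_pV2 ?posrE ?exprn_gt0 // ler_eXn2l ?ltr1n //.
  by rewrite addnn -mul2n expnS leq_mul2r d2 orbT.
apply: (le_trans (ler_wpM2l _ xS)) => //.
by rewrite mulrA ler_piMl ?(ltW (x_gt0 _)) // tail_term_le_half.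
Qed.

Let x_lt1 n : x n < 1.
Proof.
apply: lt_le_trans (tail_term_le_half n).
by rewrite ltr_pMl // ltr1n.
Qed.

Lemma partial_product_gt0 n : 0 < p n.
Proof. by apply: prodr_gt0 => t _; rewrite subr_gt0 x_lt1. Qed.

Lemma partial_product_noninc : nonincreasing_seq p.
Proof.
apply/nonincreasing_seqP => n; rewrite pS ler_piMr ?(ltW (partial_product_gt0 _)) //.
by rewrite gerBl ltW.
Qed.

Lemma partial_product_lt1 n : p n.+1 < 1.
Proof.
apply: (le_lt_trans (partial_product_noninc 1%N n.+1 isT)).
by rewrite pS /p /partial_product big_geq // mul1r gtrBl.
Qed.

(** Going from [n] to [n.+1] multiplies [p] by [1 - x n], and
    [(1 - x n) * (1 - 2 x n.+1) >= 1 - x n - 2 x n.+1 >= 1 - 2 x n]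
    since the terms at least halve. *)
Lemma lower_bound_nondec : nondecreasing_seq (fun n => p n * (1 - 2 * x n)).
Proof.
apply/nondecreasing_seqP => n; rewrite pS -mulrA ler_pM2l ?partial_product_gt0 //.
have y0 := x_gt0 n.+1; have h := tail_term_halves n.
have xy : 0 <= x n * (2 * x n.+1) by rewrite !mulr_ge0 // ltW.
rewrite -subr_ge0 [leRHS](_ : _ =
  (x n - 2 * x n.+1) + x n * (2 * x n.+1)); last by ring.
by rewrite addr_ge0 // subr_ge0.
Qed.

Lemma partial_product_enclosure n :
  p n * (1 - 2 * x n) <= f R d a <= p n.
Proof.
have cp : cvgn p by apply/cvg_ex; exists (f R d a); exact: cvg_partial_product.
apply/andP; split; last first.
  exact: (nonincreasing_cvgn_ge partial_product_noninc cp).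
apply: limr_ge => //; near=> m.
apply: (@le_trans _ _ (p m * (1 - 2 * x m))).
  by apply: lower_bound_nondec; near: m; exact: nbhs_infty_ge.
rewrite ler_piMr ?(ltW (partial_product_gt0 _)) // gerBl mulr_ge0 //.
exact: ltW.
Unshelve. all: by end_near. Qed.

Lemma partial_product_fraction n :
  p n = (numerator d a n)%:R / (denominator d a n)%:R.
Proof.
elim: n => [|n IH].
  by rewrite /p /partial_product /numerator /denominator !big_geq // big_ord0
    divr1.
rewrite pS IH /numerator /denominator big_nat_recr //= big_ord_recr /= expnD.
rewrite !natrM invfM mulrACA; congr (_ * _).
rewrite natrB ?expn_gt0 ?(ltn_trans _ a2) // /x !natrX mulrBl mul1r mulfV //.
by rewrite expf_neq0 // gt_eqF.
Qed.

(** The exponents satisfy [(d - 1) * (1 + d + ... + d^(n-1)) + 1 = d^n]. *)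
Lemma tail_term_denominator n :
  a%:R * x n = ((denominator d a n)%:R : R) ^- d.-1.
Proof.
rewrite /x /denominator natrX -exprM mulnC -predn_exp.
rewrite -{1}(@prednK (d ^ n)) ?expn_gt0 ?(ltn_trans _ d2) //.
by rewrite exprS invfM mulVKf // gt_eqF.
Qed.

Lemma partial_product_error n :
  `|f R d a - p n.+1| < ((denominator d a n.+1)%:R : R) ^- d.-1.
Proof.
rewrite -tail_term_denominator.
have /andP[lo hi] := partial_product_enclosure n.+1.
rewrite distrC ger0_norm ?subr_ge0 //.
apply: (@le_lt_trans _ _ (p n.+1 * (2 * x n.+1))).
  by rewrite lerBlDr -lerBlDl -[X in X - _]mulr1 -mulrBr.
apply: (@lt_le_trans _ _ (2 * x n.+1)).
  by rewrite gtr_pMl ?partial_product_lt1 // mulr_gt0.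
by rewrite ler_pM2r // ler_nat.
Qed.

End PartialProducts.

Lemma f_well_approximable (R : realType) (d a : nat) :
  (4 <= d)%N -> (2 <= a)%N -> well_approximable (f R d a).
Proof.
move=> d4 a2 [c c0 bad].
have d2 : (2 <= d)%N := leq_trans (isT : (2 <= 4)%N) d4.
pose n := Num.truncn c^-1; pose q := denominator d a n.+1.
have q0 : (0 < q)%N by exact: denominator_gt0.
have qR0 : 0 < (q%:R : R) by rewrite ltr0n.
have cq : c^-1 < q%:R.
  apply: (lt_trans (truncnS_gt _)); rewrite ltr_nat.
  by apply: ltn_denominator => //; exact: ltnW.
have [] := bad (numerator d a n.+1) q; first by rewrite -lt0n.
move=> _; apply/negP; rewrite -ltNge -!pmulrn -partial_product_fraction //.
apply: (lt_le_trans (@partial_product_error _ _ _ d2 a2 _)).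
rewrite -/q ler_pdivlMr ?exprn_gt0 //.
(* q^2 / q^(d-1) <= q^2 / q^3 = 1 / q < c *)
apply: (@le_trans _ _ (q%:R ^- 3 * q%:R ^+ 2)).
  rewrite ler_pM2r ?exprn_gt0 // lef_pV2 ?posrE ?exprn_gt0 //.
  by rewrite ler_weXn2l ?ler1n // -ltnS prednK // ltnW.
rewrite exprS invfM divfK ?expf_neq0 ?gt_eqF // ltW //.
by rewrite -[ltRHS]invrK ltf_pV2 ?posrE ?invr_gt0.
Qed.

Lemma infinite_approximations (R : realType) (d a : nat) :
  (2 <= d)%N -> (2 <= a)%N ->
  infinite_set (approximations (f R d a) (d%:R - 1)).
Proof.
move=> d2 a2; have d0 : (0 < d)%N := ltnW d2.
pose g n : int * int :=
  ((numerator d a n.+1)%:Z, (denominator d a n.+1)%:Z).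
have g_inj : injective g.
  by move=> m n [_ /(denominator_inj _ _ d0 a2) [->]].
apply: (@sub_infinite_set _ (range g)); last first.
  have /eq_finite_set -> : (range g #= [set: nat])%card.
    by apply: inj_card_eq => m n _ _; exact: g_inj.
  exact: infinite_nat.
move=> _ [n _ <-]; split; first by rewrite ltz_nat denominator_gt0.
rewrite /= -!pmulrn -partial_product_fraction //.
have -> : d%:R - 1 = d.-1%:R :> R by rewrite -subn1 natrB.
by rewrite powRN powR_mulrn // partial_product_error.
Qed.

Theorem proposition6 (R : realType) (d a : nat)
    (hd : (4 <= d)%N) (ha : (2 <= a)%N) :
  well_approximable (f R d a) /\
  ((d%:R - 1)%:E <= irrationality_exponent (f R d a))%E.
Proof.
have d2 : (2 <= d)%N := leq_trans (isT : (2 <= 4)%N) hd.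
split; first exact: f_well_approximable.
apply: ereal_sup_ubound; exists (d%:R - 1) => //; split.
  by rewrite subr_gt0 ltr1n.
exact: infinite_approximations.
Qed.
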